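(* Let $R$ be a self left FP-injective ring. Then each flat left $R$-module is finitely projective if and only if $R$ is left perfect.
   Context: Rings are associative with identity and modules are unitary. A left $R$-module $M$ is FP-injective if $\mathrm{Ext}^1_R(F,M)=0$ for each finitely presented left $R$-module $F$; $R$ is self left FP-injective if it is FP-injective as a left $R$-module. A left $R$-module $M$ is finitely projective if every homomorphism from a finitely generated left $R$-module into $M$ factors through a free left $R$-module. $R$ is left perfect if each flat left $R$-module is projective. *)

(* Defs.v *)
From HB Require Import structures.
From mathcomp Require Import all_boot all_algebra.
From mathcomp Require Import boolp classical_sets.
From mathcomp Require Import freeg.

Set Implicit Arguments.
Unset Strict Implicit.
Unset Printing Implicit Defensive.

Import GRing.Theory.

Local Open Scope ring_scope.
Local Open Scope quotient_scope.

(* Left R-modules are lmodType R.  A right R-module is a left module over the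
   converse ring, i.e. an lmodType R^c, in which  r *: a  stands for  a . r.
   The zero ring is allowed (pzRingType). *)

Section TensorProduct.
Variables (R : pzRingType) (A : lmodType R^c) (M : lmodType R).

Local Notation formal := {freeg (A * M)%type / int}.
Local Notation gen a m := (<< (a, m) >> : formal).

(* The subgroup of the free abelian group on A x M generated by the relations
   of biadditivity and balancedness. *)
Inductive tensor_rel : formal -> Prop :=
| tensor_rel0 : tensor_rel 0
| tensor_relB x y : tensor_rel x -> tensor_rel y -> tensor_rel (x - y)
| tensor_relDl a a' m : tensor_rel (gen (a + a') m - (gen a m + gen a' m))
| tensor_relDr a m m' : tensor_rel (gen a (m + m') - (gen a m + gen a m'))
| tensor_relZ (r : R) a m : tensor_rel (gen ((r : R^c) *: a) m - gen a (r *: m)).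

Definition tensor_ker : {pred formal} := fun x => `[< tensor_rel x >].

Lemma tensor_ker_zmod_closed : zmod_closed tensor_ker.
Proof.
split; first exact/asboolP/tensor_rel0.
by move=> x y /asboolP hx /asboolP hy; apply/asboolP/tensor_relB.
Qed.

HB.instance Definition _ := GRing.isZmodClosed.Build formal tensor_ker
  tensor_ker_zmod_closed.

Definition tensor := Quotient.quot tensor_ker.
HB.instance Definition _ := GRing.Zmodule.on tensor.
HB.instance Definition _ := EqQuotient.on tensor.

Definition tmul (a : A) (m : M) : tensor := \pi_tensor (gen a m).

Definition balanced (T : zmodType) (b : A -> M -> T) : Prop :=
  [/\ forall a a' m, b (a + a') m = b a m + b a' m,
      forall a m m', b a (m + m') = b a m + b a m' &
      forall (r : R) a m, b ((r : R^c) *: a) m = b a (r *: m)].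

Lemma tmul_balanced : balanced tmul.
Proof.
have eqI x y : tensor_rel (x - y) -> \pi_tensor x = \pi_tensor y.
  by move=> h; apply/eqP; rewrite -Quotient.idealrBE; apply/asboolP.
split=> [a a' m|a m m'|r a m]; rewrite /tmul -?raddfD /=; apply: eqI.
- exact: tensor_relDl.
- exact: tensor_relDr.
- exact: tensor_relZ.
Qed.

Section Lift.
Variables (T : zmodType) (b : A -> M -> T).

Definition formal_lift (x : formal) : T :=
  fglift (fun p => b p.1 p.2 : zmodule T) x.

Lemma formal_lift_zmod_morphism : zmod_morphism formal_lift.
Proof. exact: (@lift_is_additive _ _ (zmodule T) (fun p => b p.1 p.2)). Qed.

HB.instance Definition _ := GRing.isZmodMorphism.Build formal T formal_lift
  formal_lift_zmod_morphism.

Lemma formal_liftU a m : formal_lift (gen a m) = b a m.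
Proof. by rewrite /formal_lift liftU scale1r. Qed.

(* The additive map  a (x) m |-> b a m  induced by a balanced map b. *)
Definition tensor_lift (t : tensor) : T := formal_lift (repr t).

Hypothesis b_bal : balanced b.

Lemma tensor_lift_pi x : tensor_lift (\pi_tensor x) = formal_lift x.
Proof.
have [bDl bDr bZ] := b_bal.
have Lrel u : tensor_rel u -> formal_lift u = 0.
  elim=> [|v w _ hv _ hw|a a' m|a m m'|r a m].
  - exact: raddf0.
  - by rewrite raddfB /= hv hw subrr.
  - by rewrite raddfB raddfD /= !formal_liftU bDl subrr.
  - by rewrite raddfB raddfD /= !formal_liftU bDr subrr.
  - by rewrite raddfB /= !formal_liftU bZ subrr.
apply/eqP; rewrite -subr_eq0 -raddfB; apply/eqP/Lrel/asboolP.
have : repr (\pi_tensor x) == x %[mod tensor] by rewrite reprK.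
by rewrite -Quotient.idealrBE.
Qed.

Lemma tensor_liftE a m : tensor_lift (tmul a m) = b a m.
Proof. by rewrite tensor_lift_pi formal_liftU. Qed.

Lemma tensor_lift_zmod_morphism : zmod_morphism tensor_lift.
Proof.
move=> s t; rewrite -[s]reprK -[t]reprK -raddfB /= !tensor_lift_pi.
exact: formal_lift_zmod_morphism.
Qed.

Lemma tensor_lift_uniq (g : {additive tensor -> T}) :
  (forall a m, g (tmul a m) = b a m) -> g =1 tensor_lift.
Proof.
move=> gE t; rewrite -[t]reprK tensor_lift_pi.
elim/freeg_ind_dom0: (repr t) => [|k [a m] D _ _ IH]; first by rewrite !raddf0.
rewrite !raddfD /= IH; congr (_ + _).
have -> : << k *g (a, m) >> = gen a m *~ k by rewrite freegU_mulz intz.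
by rewrite !raddfMz /= formal_liftU -gE.
Qed.

End Lift.

End TensorProduct.

Section TensorMap.
Variables (R : pzRingType) (A B : lmodType R^c) (f : {linear A -> B}).
Variable M : lmodType R.

(* f (x) id_M *)
Definition tensor_map : tensor A M -> tensor B M :=
  tensor_lift (fun a m => tmul (f a) m).

Lemma tensor_map_balanced : balanced (fun a (m : M) => tmul (f a) m).
Proof.
have [DL DR Z] := tmul_balanced B M.
by split=> [a a' m|a m m'|r a m]; rewrite ?linearD ?linearZ /= ?DL ?DR ?Z.
Qed.

Lemma tensor_mapE a m : tensor_map (tmul a m) = tmul (f a) m.
Proof. exact: tensor_liftE tensor_map_balanced a m. Qed.

HB.instance Definition _ := GRing.isZmodMorphism.Build (tensor A M) (tensor B M)
  tensor_map (tensor_lift_zmod_morphism tensor_map_balanced).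

End TensorMap.

Arguments tensor_map {R A B} f M _.

Section Modules.
Variable R : pzRingType.
Implicit Types L M N F P : lmodType R.

Definition flat M : Prop :=
  forall (A B : lmodType R^c) (f : {linear A -> B}),
    injective f -> injective (tensor_map f M).

Definition surj (U V : Type) (f : U -> V) : Prop := forall v, exists u, f u = v.

Definition projective P : Prop :=
  forall (M N : lmodType R) (g : {linear M -> N}) (f : {linear P -> N}),
    surj g -> exists h : {linear P -> M}, forall x, g (h x) = f x.

Definition basis M (B : set M) : Prop :=
  (forall x, exists (s : seq M) (c : M -> R),
     (forall b, b \in s -> B b) /\ x = \sum_(b <- s) c b *: b) /\
  (forall (s : seq M) (c : M -> R), uniq s -> (forall b, b \in s -> B b) ->
     \sum_(b <- s) c b *: b = 0 -> forall b, b \in s -> c b = 0).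

Definition free_module M : Prop := exists B : set M, basis B.

Definition finitely_generated M : Prop :=
  exists (n : nat) (g : {linear 'rV[R]_n -> M}), surj g.

Definition finitely_presented M : Prop :=
  exists (m n : nat) (f : {linear 'rV[R]_m -> 'rV[R]_n})
         (g : {linear 'rV[R]_n -> M}),
    surj g /\ forall x, g x = 0 <-> exists y, f y = x.

Definition finitely_projective M : Prop :=
  forall N (u : {linear N -> M}), finitely_generated N ->
    exists L (v : {linear N -> L}) (w : {linear L -> M}),
      free_module L /\ forall x, u x = w (v x).

Record proj_resolution F := ProjResolution {
  res_obj :> nat -> lmodType R;
  res_d : forall n, {linear res_obj n.+1 -> res_obj n};
  res_aug : {linear res_obj 0 -> F};
  res_proj : forall n, projective (res_obj n);
  res_aug_surj : surj res_aug;
  res_aug_exact : forall x, res_aug x = 0 <-> exists y, res_d 0 y = x;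
  res_exact : forall n x, res_d n x = 0 <-> exists y, res_d n.+1 y = x
}.

(* Ext^1(F, M) = 0: for a projective resolution P of F, the complex
   Hom(P_0, M) -> Hom(P_1, M) -> Hom(P_2, M) is exact.  This does not depend
   on P. *)
Definition Ext1_eq0 F M : Prop :=
  forall (P : proj_resolution F) (f : {linear P 1%N -> M}),
    (forall x, f (res_d P 1 x) = 0) ->
    exists g : {linear P 0%N -> M}, forall x, f x = g (res_d P 0 x).

Definition FP_injective M : Prop :=
  forall F, finitely_presented F -> Ext1_eq0 F M.

End Modules.

Definition self_left_FP_injective (R : pzRingType) : Prop :=
  FP_injective (R^o : lmodType R).

Definition left_perfect (R : pzRingType) : Prop :=
  forall M : lmodType R, flat M -> projective M.

(* Main.v *)
From HB Require Import structures.
From mathcomp Require Import all_boot all_algebra.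
From mathcomp Require Import boolp classical_sets functions freeg.
Require Import Defs.

(** If every flat left module over a self left FP-injective ring R is finitely
projective, then R satisfies the descending chain condition on principal right
ideals ([finitely_projective_dcc]).  Given a_0, a_1, ..., let G be the limit of
R -> R -> ..., the n-th map being right multiplication by a_n; it is flat
([bass_flat]).  Its cyclic submodule generated by the image g of 1 in the first
copy of R maps through a free module to G.  The image of g there involves
finitely many coordinates, and the map back to G can be computed at a finite
stage, so the left annihilators of the products a_0 ... a_n stabilise
([bass_annihilator]).  FP-injectivity lets a homomorphism into R be extended
from a principal left ideal Rp to R, so whenever the left annihilator of p
kills q, q lies in pR ([FP_injective_divides]).  Hence the chain of the right
ideals a_0 ... a_n R stabilises.

The chain condition implies that every flat module M is projective
([dcc_left_perfect]); this is one implication of Bass's Theorem P, proved here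
without the Jacobson radical.  Flatness is used through one consequence
([flat_ideal_transfer]): for a right ideal I, if r y is in IM then y is in (I :
r)M, where (I : r) is the right ideal of the b with rb in I.

Two successive minimal choices of principal right ideals produce, in a nonzero
module X with that property, an idempotent e and a nonzero element y = ey such
that r y in IX implies re in I, for all I and r ([idempotent_element]).  In
particular Ry is isomorphic to Re, and Ry is pure in X.  Zorn's lemma gives a
maximal family of pairs (y, e) whose y's are independent and pure in this sense
([maximal_pure_family]).  The property above passes to the quotient by the span
of such a family ([quotient_ideal_transfer]), so a maximal family spans M:
otherwise a pair found in the quotient could be adjoined
([pure_family_adjoin]).  Then M is isomorphic to a direct sum of modules Re,
and linear maps out of M can be lifted along surjections one generator at a
time ([pure_family_projective]).

Conversely, a projective module M is a retract of a free module, and a map into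
M factors through that free module ([projective_finitely_projective]). *)

Set Implicit Arguments.
Unset Strict Implicit.
Unset Printing Implicit Defensive.

Import GRing.Theory.

Local Open Scope ring_scope.
Local Open Scope quotient_scope.

(** * Free modules *)

Section Free.
Variables (R : pzRingType) (T : choiceType).

Definition finite_support : {pred T -> R^o} :=
  fun f => `[< exists s : seq T, forall t, f t != 0 -> t \in s >].

Lemma finite_support_submod_closed : submod_closed finite_support.
Proof.
split=> [|a f g /asboolP[s fs] /asboolP[s' gs]]; apply/asboolP.
  by exists [::] => t; rewrite eqxx.
exists (s ++ s') => t; rewrite mem_cat.
have -> : (a *: f + g) t = a *: f t + g t by [].
have [f0|/fs -> //] := eqVneq (f t) 0.
have [g0|/gs ->] := eqVneq (g t) 0; last by rewrite orbT.
by rewrite f0 g0 scaler0 addr0 eqxx.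
Qed.

HB.instance Definition _ :=
  GRing.isSubmodClosed.Build R (T -> R^o) finite_support
    finite_support_submod_closed.

Record freeMod := FreeMod {
  free_val : T -> R^o;
  free_valP : free_val \in finite_support }.

HB.instance Definition _ := [isSub for free_val].
HB.instance Definition _ := [Choice of freeMod by <:].
HB.instance Definition _ := [SubChoice_isSubLmodule of freeMod by <:].

Definition coeff (x : freeMod) : T -> R := free_val x.
Local Coercion coeff : freeMod >-> Funclass.
Arguments coeff : simpl never.

Lemma free_eqP (x y : freeMod) : (forall t, x t = y t) -> x = y.
Proof. by move=> xy; apply: val_inj; apply: funext. Qed.

Lemma coeffD (x y : freeMod) t : (x + y) t = x t + y t. Proof. by []. Qed.
Lemma coeffZ a (x : freeMod) t : (a *: x) t = a * x t. Proof. by []. Qed.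

Lemma coeff_sum I (s : seq I) (F : I -> freeMod) t :
  (\sum_(i <- s) F i) t = \sum_(i <- s) F i t.
Proof. by elim: s => [|i s IH]; rewrite ?big_nil // !big_cons coeffD IH. Qed.

Lemma delta_finite (t : T) :
  (fun u => if u == t then 1 else 0 : R^o) \in finite_support.
Proof.
apply/asboolP; exists [:: t] => u; rewrite mem_seq1.
by case: (u == t) => //; rewrite eqxx.
Qed.

Definition delta (t : T) : freeMod := FreeMod (delta_finite t).

Lemma coeff_delta t u : delta t u = if u == t then 1 else 0.
Proof. by []. Qed.

Lemma supp_ex (x : freeMod) :
  exists s : seq T, uniq s /\ forall t, x t != 0 -> t \in s.
Proof.
have /asboolP[s xs] := free_valP x.
by exists (undup s); split=> [|t /xs]; rewrite ?undup_uniq ?mem_undup.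
Qed.

(** Some finite duplicate-free list that contains the support, possibly larger
than the support. *)
Definition supp (x : freeMod) := projT1 (cid (supp_ex x)).
Lemma supp_uniq (x : freeMod) : uniq (supp x).
Proof. by rewrite /supp; case: cid => s []. Qed.
Lemma mem_supp (x : freeMod) t : x t != 0 -> t \in supp x.
Proof. by rewrite /supp; case: cid => s []/= _; apply. Qed.

Section Lift.
Variables (M : lmodType R) (phi : T -> M).

Definition free_lift (x : freeMod) : M := \sum_(t <- supp x) x t *: phi t.

Lemma free_liftE (x : freeMod) (s : seq T) : uniq s ->
  (forall t, x t != 0 -> t \in s) ->
  free_lift x = \sum_(t <- s) x t *: phi t.
Proof.
have red (s' : seq T) : \sum_(t <- s') x t *: phi t =
    \sum_(t <- [seq t <- s' | x t != 0]) x t *: phi t.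
  rewrite big_filter [RHS]big_mkcond; apply: eq_bigr => t _.
  by case: eqP => //= ->; rewrite scale0r.
move=> us xs; rewrite /free_lift red [RHS]red; apply: perm_big.
apply: uniq_perm; rewrite ?filter_uniq ?supp_uniq // => t.
rewrite !mem_filter; case: eqP => //= /eqP xt.
by rewrite (mem_supp xt) (xs _ xt).
Qed.

Lemma free_lift_linear : linear free_lift.
Proof.
move=> a x y; pose s := undup (supp x ++ supp y ++ supp (a *: x + y)).
have us : uniq s by apply: undup_uniq.
rewrite !(@free_liftE _ s) //;
  try by move=> t /mem_supp; rewrite mem_undup !mem_cat => ->; rewrite ?orbT.
rewrite scaler_sumr -big_split; apply: eq_bigr => t _ /=.
by rewrite coeffD coeffZ scalerDl scalerA.
Qed.

HB.instance Definition _ := GRing.isLinear.Build R freeMod M *:%R free_lift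
  free_lift_linear.

Lemma free_lift_delta t : free_lift (delta t) = phi t.
Proof.
rewrite (@free_liftE _ [:: t]) //; last first.
  by move=> u; rewrite coeff_delta mem_seq1; case: (u == t); rewrite ?eqxx.
by rewrite big_seq1 coeff_delta eqxx scale1r.
Qed.

End Lift.

Lemma free_sum (x : freeMod) : x = \sum_(t <- supp x) x t *: delta t.
Proof.
apply: free_eqP => u; rewrite coeff_sum.
have [|/eqP xu] := boolP (u \in supp x).
  move=> us; rewrite (bigD1_seq u) ?supp_uniq //= coeffZ coeff_delta eqxx mulr1.
  rewrite big1 ?addr0 // => t tu.
  by rewrite coeffZ coeff_delta eq_sym (negPf tu) mulr0.
have -> : x u = 0.
  by apply/eqP; apply: contraT => /mem_supp; move/eqP: xu => /negPf ->.
rewrite big_seq big1 // => t ts; rewrite coeffZ coeff_delta.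
case: eqP => [ut|_].
  by move: xu; rewrite ut ts.
by rewrite mulr0.
Qed.

Lemma free_linear_ext (M : lmodType R) (h k : {linear freeMod -> M}) :
  (forall t, h (delta t) = k (delta t)) -> h =1 k.
Proof.
move=> hk x; rewrite [x]free_sum !linear_sum; apply: eq_bigr => t _.
by rewrite !linearZ /= hk.
Qed.

(** Over the zero ring [delta] is not injective, so the coordinates of an
element are read off from its basis vectors by choice; they are well defined
because two indices with the same basis vector force 1 = 0. *)
Lemma freeMod_free : free_module (freeMod : lmodType R).
Proof.
exists [set x | exists t, x = delta t]%classic; split=> [x|s c us sB s0 b bs].
  have cE b : exists r : R, forall t, b = delta t -> x t = r.
    have [[t ->]|nb] := pselect (exists t, b = delta t); last first.
      by exists 0 => t bt; case: nb; exists t.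
    exists (x t) => u /(congr1 (fun y : freeMod => y u)).
    rewrite !coeff_delta eqxx.
    case: eqP => [-> //|_ z]; rewrite -[x u]mul1r -[x t]mul1r.
    by rewrite -[1 in LHS]z -[1 in RHS]z !mul0r.
  have [c cP] := choice cE.
  exists (map delta (supp x)), c; split=> [b /mapP[t _ ->]|]; first by exists t.
  rewrite big_map {1}[x]free_sum; apply: eq_bigr => t _.
  by rewrite -(cP _ _ erefl).
have [t bt] := sB b bs.
have := congr1 (fun y : freeMod => y t) s0.
rewrite coeff_sum (bigD1_seq b) //= coeffZ {2}bt coeff_delta eqxx mulr1.
rewrite big1_seq ?addr0 //.
move=> b' /andP[b'b b's]; have [t' bt'] := sB _ b's.
rewrite coeffZ bt' coeff_delta; case: eqP => [tt|_]; last by rewrite mulr0.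
by move: b'b; rewrite bt bt' tt eqxx.
Qed.

Lemma freeMod_projective : projective (freeMod : lmodType R).
Proof.
move=> M N g f gs.
pose phi t := projT1 (cid (gs (f (delta t)))).
have gphi t : g (phi t) = f (delta t) by rewrite /phi; case: cid.
exists (free_lift phi); apply: (free_linear_ext (h := g \o free_lift phi)) => t.
by rewrite /= free_lift_delta gphi.
Qed.

End Free.

(** * Quotient modules *)

Section Quotient.
Variables (R : pzRingType) (M : lmodType R).

Definition submodule (S : M -> Prop) : Prop :=
  S 0 /\ forall a x y, S x -> S y -> S (a *: x + y).

Variables (S : M -> Prop) (subS : submodule S).

(** The proof of closedness is an argument of the predicate so that the
canonical additive structure on it can be inferred. *)
Definition quot_ker of submodule S : {pred M} := fun x => `[< S x >].
Local Notation K := (quot_ker subS).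

Lemma quot_ker_zmod_closed : zmod_closed K.
Proof.
have [S0 SD] := subS; split; first exact/asboolP.
move=> x y /asboolP Sx /asboolP Sy; apply/asboolP.
by rewrite addrC -scaleN1r; apply: SD.
Qed.

HB.instance Definition _ := GRing.isZmodClosed.Build M K quot_ker_zmod_closed.

Definition quot := Quotient.quot K.
HB.instance Definition _ := GRing.Zmodule.on quot.
HB.instance Definition _ := EqQuotient.on quot.

Lemma quot_eqP x y : \pi_quot x = \pi_quot y <-> S (x - y).
Proof.
split=> [xy|Sxy]; last by apply/eqP; rewrite -Quotient.idealrBE; apply/asboolP.
by apply/asboolP; rewrite -[asbool _]/(x - y \in K) Quotient.idealrBE xy.
Qed.

Definition quot_scale (a : R) (u : quot) : quot := \pi_quot (a *: repr u).

Lemma quot_scale_pi a x : quot_scale a (\pi_quot x) = \pi_quot (a *: x).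
Proof.
apply/quot_eqP; rewrite -scalerBr; have [S0 SD] := subS.
rewrite -[_ *: _]addr0; apply: SD => //.
by apply/quot_eqP; rewrite reprK.
Qed.

Lemma quot_scaleA a b u : quot_scale a (quot_scale b u) = quot_scale (a * b) u.
Proof. by rewrite -[u]reprK (quot_scale_pi b) !quot_scale_pi scalerA. Qed.
Lemma quot_scale1 : left_id 1 quot_scale.
Proof. by move=> u; rewrite -[u]reprK quot_scale_pi scale1r. Qed.
Lemma quot_scaleDr : right_distributive quot_scale +%R.
Proof.
move=> a u v; rewrite -[u]reprK -[v]reprK -raddfD !quot_scale_pi -raddfD.
by rewrite scalerDr.
Qed.
Lemma quot_scaleDl u : {morph quot_scale^~ u : a b / a + b}.
Proof. by move=> a b; rewrite -[u]reprK !quot_scale_pi -raddfD scalerDl. Qed.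

HB.instance Definition _ := GRing.Zmodule_isLmodule.Build R quot
  quot_scaleA quot_scale1 quot_scaleDr quot_scaleDl.

Definition quot_proj (x : M) : quot := \pi_quot x.

Lemma quot_proj_linear : linear quot_proj.
Proof.
move=> a x y; rewrite /quot_proj raddfD.
by rewrite -[a *: \pi_quot x]/(quot_scale a (\pi_quot x)) quot_scale_pi.
Qed.

HB.instance Definition _ := GRing.isLinear.Build R M quot *:%R quot_proj
  quot_proj_linear.

Lemma quotient_exists : exists (Q : lmodType R) (q : {linear M -> Q}),
  surj q /\ forall x, q x = 0 <-> S x.
Proof.
exists (quot : lmodType R), quot_proj; split=> [u|x].
  by exists (repr u); rewrite -[RHS]reprK.
by rewrite -[x in S x]subr0 -quot_eqP -[in X in _ <-> X]/(quot_proj 0) linear0.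
Qed.

End Quotient.

Definition bundle_linear (R : pzRingType) (M N : lmodType R) (f : M -> N)
    (fl : linear f) : {linear M -> N} :=
  HB.pack f (GRing.isLinear.Build R M N *:%R f fl).

Lemma linear_factor (R : pzRingType) (F M N : lmodType R)
    (q : {linear F -> M}) (k : {linear F -> N}) :
  surj q -> (forall x, q x = 0 -> k x = 0) ->
  exists h : {linear M -> N}, forall x, h (q x) = k x.
Proof.
move=> qs qk; have [s sK] := choice qs.
pose h u := k (s u).
have hE x : h (q x) = k x.
  by apply/eqP; rewrite -subr_eq0 -linearB qk // linearB /= sK subrr.
have hl : linear h.
  by move=> a u v; rewrite -[u]sK -[v]sK -linearP !hE linearP.
by exists (bundle_linear hl).
Qed.

(** * Consequences of FP-injectivity *)

Section RightMul.
Variable R : pzRingType.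
Implicit Types (M : lmodType R).

(** The linear map R -> M that sends 1 to [m]; for M = R it is the right
multiplication by [m]. *)
Definition regular_map M (m : M) (r : R^o) : M := (r : R) *: m.
Lemma regular_map_linear M (m : M) : linear (regular_map m).
Proof. by move=> a r s; rewrite /regular_map scalerDl scalerA. Qed.
HB.instance Definition _ M (m : M) :=
  GRing.isLinear.Build R R^o M *:%R (regular_map m) (regular_map_linear m).

Lemma regular_projective : projective (R^o : lmodType R).
Proof.
move=> M N g f gs; have [m gm] := gs (f (1 : R)).
exists (regular_map m) => r.
by rewrite /= /regular_map linearZ /= gm -linearZ /= [_ *: _]mulr1.
Qed.

(** One arrow of a resolution together with its ends, so that a resolution can
be produced by iterating one operation on arrows. *)
Record step := Step {
  src : lmodType R;
  tgt : lmodType R;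
  arrow : {linear src -> tgt} }.

(** Taking every element of the source as a generator, and sending those
outside the kernel to 0, gives a free module that covers the kernel without
forming the kernel as a module. *)
Definition kernel_cover (s : step) : step :=
  Step (free_lift (fun x : src s => if arrow s x == 0 then x else 0)).

Lemma kernel_cover_exact (s : step) (x : src s) :
  arrow s x = 0 <-> exists y, arrow (kernel_cover s) y = x.
Proof.
split=> [x0|[y <-]].
  by exists (delta R x); rewrite /= free_lift_delta x0 eqxx.
rewrite /= /free_lift linear_sum big1 // => t _; rewrite linearZ /=.
by case: eqP => [->|_]; rewrite ?linear0 scaler0.
Qed.

Definition steps (f : {linear R^o -> R^o}) (n : nat) : step :=
  iter n kernel_cover (Step f).

(** Terms 0 and 1 are both R, joined by [f]; the later ones are free. *)
Definition resolution_obj f n : lmodType R := tgt (steps f n).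
Definition resolution_d f n :
  {linear resolution_obj f n.+1 -> resolution_obj f n} := arrow (steps f n).

Lemma resolution_of (f : {linear R^o -> R^o}) (F : lmodType R)
    (aug : {linear R^o -> F}) :
  surj aug -> (forall x, aug x = 0 <-> exists y, f y = x) -> proj_resolution F.
Proof.
move=> aug_surj aug_exact.
apply: (@ProjResolution _ F (resolution_obj f) (resolution_d f) aug) => //.
- case=> [|[|n]]; [exact: regular_projective|exact: regular_projective|].
  exact: freeMod_projective.
- by move=> n x; apply: kernel_cover_exact.
Defined.

Lemma row1_entry_linear : linear (fun v : 'rV[R]_1 => (v 0 0 : R^o)).
Proof. by move=> a v w; rewrite !mxE. Qed.
Lemma row1_of_linear : linear (fun r : R^o => const_mx r : 'rV[R]_1).
Proof. by move=> a r s; apply/rowP => j; rewrite !mxE. Qed.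

Definition row1_entry := bundle_linear row1_entry_linear.
Definition row1_of := bundle_linear row1_of_linear.

Lemma row1_entryK : cancel row1_entry row1_of.
Proof. by move=> v; apply/rowP => j; rewrite /= mxE ord1. Qed.

Lemma cyclic_finitely_generated (N : lmodType R) (q : {linear R^o -> N}) :
  surj q -> finitely_generated N.
Proof.
move=> q_surj; exists 1%N, (q \o row1_entry) => u; have [r <-] := q_surj u.
by exists (row1_of r); rewrite /= mxE.
Qed.

(** The assignment r p |-> r q is well defined on Rp.  As R / Rp is finitely
presented, it extends to an endomorphism of R, which is a right multiplication
by some c. *)
Lemma FP_injective_divides (p q : R) : self_left_FP_injective R ->
  (forall r, r * p = 0 -> r * q = 0) -> exists c, q = p * c.
Proof.
move=> injR pq.
have subI : submodule (fun x : R^o => exists y, regular_map (p : R^o) y = x).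
  split=> [|a x y [x' <-] [y' <-]]; first by exists 0; rewrite linear0.
  by exists (a *: x' + y'); rewrite linearP.
have [F [aug [aug_surj aug_exact]]] := quotient_exists subI.
have fpF : finitely_presented F.
  exists 1%N, 1%N, (row1_of \o regular_map (p : R^o) \o row1_entry).
  exists (aug \o row1_entry); split=> [u|v].
    by have [x <-] := aug_surj u; exists (row1_of x); rewrite /= mxE.
  split=> [/aug_exact[y yv]|[w <-]].
    by exists (row1_of y); rewrite -[RHS]row1_entryK -yv /= mxE.
  by apply/aug_exact; exists (row1_entry w); rewrite /= mxE.
have := @injR F fpF (resolution_of aug_surj aug_exact) (regular_map (q : R^o)).
case=> [x|g gE].
  apply: pq; apply/(kernel_cover_exact (s := Step (regular_map (p : R^o)))).
  by exists x.
(* At 1 the extension property reads q = g(p), and g(p) = p g(1). *)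
exists (g (1 : R)); have := gE (1 : R).
rewrite /= /resolution_d /= /regular_map.
rewrite ![1 *: _]mul1r => ->.
by rewrite -[p in LHS]mulr1 -[_ * _]/(p *: (1 : R^o)) linearZ.
Qed.
End RightMul.

(** * Tensor products and flatness *)

Section Tensor.
Variable R : pzRingType.

(** The way elements of a tensor product are shown to be nonzero: it is enough
for [b] to be balanced up to a subgroup [Z] of the target, so no quotient by
[Z] has to be formed. *)
Lemma tmul_eq0_modulo (A : lmodType R^c) (M : lmodType R) (T : zmodType)
    (b : A -> M -> T) (Z : T -> Prop) :
  Z 0 -> (forall x y, Z x -> Z y -> Z (x - y)) ->
  (forall a a' m, Z (b (a + a') m - (b a m + b a' m))) ->
  (forall a m m', Z (b a (m + m') - (b a m + b a m'))) ->
  (forall (r : R) a m, Z (b ((r : R^c) *: a) m - b a (r *: m))) ->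
  forall a m, tmul a m = 0 -> Z (b a m).
Proof.
move=> Z0 ZB ZDl ZDr ZZ a m am0.
have Zrel u : tensor_rel u -> Z (formal_lift b u).
  elim=> [|v w _ hv _ hw|a1 a2 n|a1 n n'|r a1 n].
  - by rewrite raddf0.
  - by rewrite raddfB; apply: ZB.
  - by rewrite raddfB raddfD /= !formal_liftU.
  - by rewrite raddfB raddfD /= !formal_liftU.
  - by rewrite raddfB /= !formal_liftU.
rewrite -(formal_liftU b); apply: Zrel.
have /eqP : tmul a m = \pi_(tensor A M) 0 by rewrite am0 raddf0.
by rewrite /tmul -Quotient.idealrBE subr0 => /asboolP.
Qed.

Lemma tensor_ind (A : lmodType R^c) (M : lmodType R) (P : tensor A M -> Prop) :
  P 0 -> (forall x y, P x -> P y -> P (x - y)) ->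
  (forall u m, P (tmul u m)) -> forall t, P t.
Proof.
move=> P0 PB Pt t.
have PN x : P x -> P (- x) by move=> Px; rewrite -[- x]add0r; apply: PB.
have PD x y : P x -> P y -> P (x + y).
  by move=> Px Py; rewrite -[y]opprK; apply/PB/PN.
rewrite -[t]reprK.
elim/freeg_ind_dom0: (repr t) => [|k [u m] D _ _ IH]; first by rewrite raddf0.
rewrite raddfD /=; apply: (PD) IH.
have -> : << k *g (u, m) >> = (<< (u, m) >> *~ k : {freeg (A * M)%type / int}).
  by rewrite freegU_mulz intz.
rewrite raddfMz /= -/(tmul u m).
have Pn n : P (tmul u m *+ n) by elim: n => // n IHn; rewrite mulrS; apply: PD.
by case: k => n; [exact: Pn|rewrite NegzE mulrNz; apply/PN/Pn].
Qed.

(** Phrased through [submodule] over the converse ring, so that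
[quotient_exists] gives R / I as a right module. *)
Definition right_ideal (I : R -> Prop) : Prop :=
  submodule (I : (R^c^o : lmodType R^c) -> Prop).

(** The additive subgroup IM of M. *)
Definition ideal_span (M : lmodType R) (I : R -> Prop) (x : M) : Prop :=
  exists s : seq (R * M), (forall p, p \in s -> I p.1) /\
    x = \sum_(p <- s) p.1 *: p.2.

Section IdealSpan.
Variables (M : lmodType R) (I : R -> Prop) (rI : right_ideal I).

Lemma right_idealM a r : I a -> I (a * r).
Proof.
move=> Ia; have [I0 /(_ (r : R^c) a 0 Ia I0)] := rI.
by rewrite addr0.
Qed.

Lemma right_idealN a : I a -> I (- a).
Proof. by move=> Ia; rewrite -mulrN1; apply: right_idealM. Qed.

Lemma ideal_span0 : ideal_span I (0 : M).
Proof. by exists [::]; rewrite big_nil. Qed.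

Lemma ideal_spanD (x y : M) :
  ideal_span I x -> ideal_span I y -> ideal_span I (x + y).
Proof.
move=> [s [sI ->]] [t [tI ->]]; exists (s ++ t); rewrite big_cat; split=> // p.
by rewrite mem_cat => /orP[/sI|/tI].
Qed.

Lemma ideal_spanZ (a : R) (m : M) : I a -> ideal_span I (a *: m).
Proof.
move=> Ia; exists [:: (a, m)]; rewrite big_seq1; split=> // p.
by rewrite mem_seq1 => /eqP ->.
Qed.

Lemma ideal_span_sum J (s : seq J) (F : J -> M) :
  (forall j, ideal_span I (F j)) -> ideal_span I (\sum_(j <- s) F j).
Proof.
by move=> IF; apply: (big_ind (ideal_span I) ideal_span0 ideal_spanD).
Qed.

Lemma ideal_spanN (x : M) : ideal_span I x -> ideal_span I (- x).
Proof.
move=> [s [sI ->]]; rewrite -sumrN big_seq.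
apply: (big_ind (ideal_span I) ideal_span0 ideal_spanD) => p ps.
by rewrite -scaleNr; apply/ideal_spanZ/right_idealN/sI.
Qed.

Lemma ideal_spanB (x y : M) :
  ideal_span I x -> ideal_span I y -> ideal_span I (x - y).
Proof. by move=> Ix Iy; apply/ideal_spanD/ideal_spanN. Qed.

End IdealSpan.

Lemma right_ideal_colon I (r : R) :
  right_ideal I -> right_ideal (fun b => I (r * b)).
Proof.
move=> [I0 ID]; split=> [|a x y Ix Iy]; first by rewrite mulr0.
change (I (r * ((x : R) * (a : R) + (y : R)))); rewrite mulrDr mulrA.
exact: (ID a _ _ Ix Iy).
Qed.

(** This says, on elements, that left multiplication by r, which maps R / (I :
r) injectively to R / I for (I : r) the right ideal of the b with r b in I,
stays injective after tensoring with M. *)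
Definition ideal_transfer (M : lmodType R) : Prop :=
  forall (I : R -> Prop) (r : R) (y : M), right_ideal I ->
    ideal_span I (r *: y) -> ideal_span (fun b => I (r * b)) y.

(** Left multiplication by r induces an injection of right modules from R / (I
: r) to R / I.  Tensored with M it sends the class of 1 (x) y to 1 (x) r y = 0,
so 1 (x) y = 0 in R / (I : r) (x) M = M / (I : r)M. *)
Lemma flat_ideal_transfer (M : lmodType R) : flat M -> ideal_transfer M.
Proof.
move=> flatM I r y rI [s [sI ry]].
pose K b := I (r * b).
have rK : right_ideal K := right_ideal_colon r rI.
have [A [pA [pA_surj pA0]]] := quotient_exists rK.
have [B [pB [pB_surj pB0]]] := quotient_exists rI.
have [bDl bDr bZ] := tmul_balanced B M.
have lin_r : linear (fun b : R^c^o => pB (r * (b : R))).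
  move=> a u v; rewrite -linearP; congr (pB _).
  by change (r * ((u : R) * (a : R) + (v : R)) = r * u * a + r * v);
    rewrite mulrDr mulrA.
have [f fE] : exists f : {linear A -> B}, forall b : R, f (pA b) = pB (r * b).
  by apply: (linear_factor (k := bundle_linear lin_r)) => // b /pA0 /pB0.
have f_inj : injective f.
  move=> u v; have [[b <-] [c <-]] := (pA_surj u, pA_surj v) => /eqP.
  rewrite -subr_eq0 -!linearB /= => /eqP.
  rewrite fE => /pB0 Kbc; apply/eqP; rewrite -subr_eq0 -linearB.
  exact/eqP/pA0.
have pBE (i : R) : pB i = (i : R^c) *: pB 1.
  by rewrite -linearZ; congr (pB _); rewrite -[RHS]/(1 * i : R) mul1r.
have tI : tmul (pB 1) (r *: y) = 0.
  rewrite ry; have bs0 : forall a : B, tmul a (0 : M) = 0.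
    by move=> a; apply: (@addrI _ (tmul a 0)); rewrite -bDr !addr0.
  have b0s (m : M) : tmul (0 : B) m = 0.
    by apply: (@addrI _ (tmul 0 m)); rewrite -bDl !addr0.
  rewrite (big_morph (tmul (pB 1)) (bDr _) (bs0 _)) big_seq big1 // => p ps.
  rewrite -bZ -pBE; have /pB0 -> := sI p ps.
  exact: b0s.
have t0 : tmul (pA 1) y = 0.
  apply: (flatM _ _ f f_inj); rewrite raddf0 tensor_mapE fE mulr1 pBE bZ.
  exact: tI.
have [sc scK] := choice pA_surj.
have KK (u v : R) : pA u = pA v -> K (u - v).
  by move=> uv; apply/pA0; rewrite linearB uv subrr.
have KZ (k : R) (m : M) : K k -> ideal_span K (k *: m) by apply: ideal_spanZ.
have Ky : ideal_span K ((sc (pA 1) : R) *: y).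
  apply: (tmul_eq0_modulo (b := fun u (m : M) => (sc u : R) *: m)) t0.
  - exact: ideal_span0.
  - exact: ideal_spanB.
  - move=> u v m; rewrite -scalerDl -scalerBl; apply: KZ.
    by apply: KK; rewrite linearD !scK.
  - by move=> u m m'; rewrite scalerDr subrr; apply: ideal_span0.
  - move=> a u m; rewrite scalerA -scalerBl; apply/KZ/KK.
    by rewrite -[(sc u : R) * a]/((a : R^c) *: sc u) linearZ !scK.
have -> : y = (sc (pA 1) : R) *: y - ((sc (pA 1) : R) - 1) *: y.
  by rewrite scalerBl scale1r opprB addrC subrK.
by apply: ideal_spanB Ky _ => //; apply/KZ/KK; rewrite scK.
Qed.

End Tensor.

(** * The direct limit of a sequence of right multiplications *)

Definition eventually (P : nat -> Prop) : Prop :=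
  exists N, forall n, (N <= n)%N -> P n.

Lemma eventually_and (P Q S : nat -> Prop) :
  (forall n, P n -> Q n -> S n) -> eventually P -> eventually Q -> eventually S.
Proof.
move=> PQS [N HN] [N' HN']; exists (maxn N N') => n.
by rewrite geq_max => /andP[/HN Pn /HN' Qn]; apply: PQS.
Qed.

Lemma eventually_all (T : eqType) (s : seq T) (P : T -> nat -> Prop) :
  (forall t, t \in s -> eventually (P t)) ->
  eventually (fun n => forall t, t \in s -> P t n).
Proof.
elim: s => [|t s IH] Ps; first by exists 0%N.
apply: (eventually_and _ (Ps t (mem_head t s)) (IH _)) => [n Pt Ps' u|u us].
  by rewrite inE => /orP[/eqP ->|/Ps'].
by apply: Ps; rewrite inE us orbT.
Qed.

Section BassModule.
Variables (R : pzRingType) (a : nat -> R).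

Local Notation seg i n := (\prod_(i <= k < n) a k).

(** An axiomatic description of the limit G of R -> R -> ..., the n-th map
being right multiplication by [a n]: [gamma n] is the image of 1 in the n-th
copy of R, and [lev n x] is a coordinate of [x] in that copy.  The coordinates
are only determined, and only linear in [x], for large n. *)
Record bass_system (G : lmodType R) (gamma : nat -> G) (lev : nat -> G -> R) :
    Prop := {
  bass_seg : forall i n, (i <= n)%N -> gamma i = seg i n *: gamma n;
  bass_span : forall x, eventually (fun n => exists r, x = r *: gamma n);
  bass_levD : forall x y,
    eventually (fun n => lev n (x + y) = lev n x + lev n y);
  bass_levZ : forall r x, eventually (fun n => lev n (r *: x) = r * lev n x);
  bass_lev : forall i, eventually (fun n => lev n (gamma i) = seg i n)
}.

(** The limit is the free module on the naturals modulo the elements whose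
coordinates [L n] vanish for all large n.  A lift to the free module chosen for
each element of the quotient gives [lev]. *)
Lemma bass_exists : exists G gamma lev, @bass_system G gamma lev.
Proof.
pose F := freeMod R nat.
pose L n : {linear F -> R^o} :=
  free_lift (fun i => if (i <= n)%N then (seg i n : R^o) else 0).
have LE i n : (i <= n)%N -> L n (delta R i) = seg i n.
  by move=> i_n; rewrite /L /= free_lift_delta i_n.
pose K (f : F) := eventually (fun n => L n f = 0).
have subK : submodule K.
  split=> [|r f g]; first by exists 0%N => n _; rewrite linear0.
  apply: eventually_and => n Lf Lg.
  by rewrite linearP Lf Lg scaler0 addr0.
have [G [p [p_surj p0]]] := quotient_exists subK.
have pK f g : p f = p g -> K (f - g).
  by move=> fg; apply/p0; rewrite linearB fg subrr.
have [s sK] := choice p_surj.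
have segE i n : (i <= n)%N -> p (delta R i) = seg i n *: p (delta R n).
  move=> i_n; apply/eqP; rewrite -subr_eq0 -linearZ -linearB; apply/eqP/p0.
  exists n => m n_m; rewrite linearB linearZ /= !LE // ?(leq_trans i_n) //.
  by rewrite (big_cat_nat i_n n_m) subrr.
exists G, (fun i => p (delta R i)), (fun n x => L n (s x)); split=> //.
- move=> x; have [f <-] := p_surj x.
  have [N HN] : eventually (fun n => forall i, i \in supp f -> (i <= n)%N).
    by apply: eventually_all => i _; exists i.
  exists N => n /HN fn; exists (\sum_(i <- supp f) coeff f i * seg i n).
  rewrite scaler_suml {1}[f]free_sum linear_sum big_seq [RHS]big_seq.
  by apply: eq_bigr => i /fn i_n; rewrite linearZ /= (segE _ _ i_n) scalerA.
- move=> x y; have [|N HN] := @pK (s (x + y)) (s x + s y).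
    by rewrite linearD !sK.
  exists N => n /HN /eqP; rewrite linearB subr_eq0 => /eqP ->.
  by rewrite linearD.
- move=> r x; have [|N HN] := @pK (s (r *: x)) (r *: s x).
    by rewrite linearZ !sK.
  exists N => n /HN /eqP; rewrite linearB subr_eq0 => /eqP ->.
  by rewrite linearZ.
- move=> i; have [|N HN] := @pK (s (p (delta R i))) (delta R i).
    by rewrite sK.
  exists (maxn i N) => n; rewrite geq_max => /andP[i_n /HN /eqP].
  by rewrite linearB subr_eq0 => /eqP ->; apply: LE.
Qed.

Section Theory.
Variables (G : lmodType R) (gamma : nat -> G) (lev : nat -> G -> R).
Hypothesis bass : bass_system gamma lev.

Lemma bass_eq0 r i :
  r *: gamma i = 0 -> exists2 n, (i <= n)%N & r * seg i n = 0.
Proof.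
move=> r0.
have [N1 H1] := bass_levZ bass r (gamma i).
have [N2 H2] := bass_lev bass i.
have [N3 H3] := bass_levD bass 0 0.
pose n := maxn i (maxn N1 (maxn N2 N3)); exists n; first exact: leq_maxl.
rewrite -H2 -?H1 ?r0; try by rewrite /n !leq_max leqnn ?orbT.
by apply: (@addrI _ (lev n 0)); rewrite -H3 ?addr0 // /n !leq_max leqnn ?orbT.
Qed.

Lemma bass_tensor (A : lmodType R^c) (t : tensor A G) :
  eventually (fun n => exists u : A, t = tmul u (gamma n)).
Proof.
have [bDl bDr bZ] := tmul_balanced A G.
elim/tensor_ind: t => [|x y|u m].
- exists 0%N => n _; exists 0; apply: (@addrI _ (tmul 0 (gamma n))).
  by rewrite -bDl !addr0.
- apply: eventually_and => n [u ->] [v ->]; exists (u - v).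
  by apply: (@addIr _ (tmul v (gamma n))); rewrite -bDl !subrK.
- have [N HN] := bass_span bass m; exists N => n /HN[r ->].
  by exists ((r : R^c) *: u); rewrite bZ.
Qed.

(** Every tensor is of the form u (x) gamma_N.  If f(u) (x) gamma_N = 0 then
f(u) is killed by a product a_N ... a_(n-1), so u is killed by it as f is
injective, and u (x) gamma_N = u a_N ... a_(n-1) (x) gamma_n = 0. *)
Lemma bass_flat : flat G.
Proof.
move=> A B f f_inj; apply: raddf_inj => t.
have [bDl bDr bZ] := tmul_balanced A G.
have [N HN] := bass_tensor t; have [u ->] := HN N (leqnn N).
rewrite [_ (tmul _ _)]tensor_mapE => fu0.
(* Up to finitely many terms, this sequence is the value of w (x) x in the
limit of the copies of B. *)
pose b (w : B) (x : G) : nat -> B := fun n => (lev n x : R^c) *: w.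
have : eventually (fun n => b (f u) (gamma N) n = 0).
  pose Z (h : nat -> B) := eventually (fun n => h n = 0).
  apply: (tmul_eq0_modulo (b := b) (Z := Z)) fu0.
  - by exists 0%N.
  - move=> x y; apply: eventually_and => n xn yn.
    by rewrite -[(x - y) n]/(x n - y n) xn yn subrr.
  - move=> w w' x; exists 0%N => n _.
    by rewrite -[LHS]/(b (w + w') x n - (b w x n + b w' x n)) /b scalerDr subrr.
  - move=> w x x'; have [n0 H] := bass_levD bass x x'; exists n0 => n /H E.
    rewrite -[LHS]/(b w (x + x') n - (b w x n + b w x' n)) /b E scalerDl.
    by rewrite subrr.
  - move=> r w x; have [n0 H] := bass_levZ bass r x; exists n0 => n /H E.
    rewrite -[LHS]/(b ((r : R^c) *: w) x n - b w (r *: x) n) /b E scalerA.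
    by rewrite -[(lev n x : R^c) * _]/(r * lev n x) subrr.
move=> [N1 H1]; have [N2 H2] := bass_lev bass N.
pose n := maxn N (maxn N1 N2).
have := H1 n; rewrite /b H2 /n ?leq_max ?leqnn ?orbT // => /(_ isT).
rewrite -/n -linearZ /= -[X in _ = X -> _](linear0 f) => /f_inj Pu.
rewrite (bass_seg bass (leq_maxl N (maxn N1 N2))) -/n -bZ Pu.
by apply: (@addrI _ (tmul 0 (gamma n))); rewrite -bDl !addr0.
Qed.

(** Let N be the cyclic module R gamma_0, factored as N -> F -> G with F free,
and let c_b be the coordinates in F of the image of gamma_0.  Writing the
images in G of the basis vectors as multiples of one gamma_n and then passing
to a later stage m gives a_0 ... a_(m-1) as a sum of elements of the c_b R.
Anything that annihilates a later product annihilates gamma_0, hence every c_b,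
hence a_0 ... a_(m-1). *)
Lemma bass_annihilator : finitely_projective G ->
  exists m, forall k, (m <= k)%N ->
    forall r, r * seg 0 k = 0 -> r * seg 0 m = 0.
Proof.
move=> fpG.
have subI : submodule (fun r : R^o => regular_map (gamma 0) r = 0).
  split=> [|r x y]; first by rewrite linear0.
  by move=> x0 y0; rewrite regular_map_linear x0 y0 scaler0 addr0.
have [N [q [q_surj q0]]] := quotient_exists subI.
have [u uE] := linear_factor q_surj (fun x => (q0 x).1).
have fgN := cyclic_finitely_generated q_surj.
have [F [v [w [[B [Bspan Bfree]] uvw]]]] := fpG N u fgN.
have [s [c [us [sB vE]]]] : exists (s : seq F) (c : F -> R), uniq s /\
    (forall b, b \in s -> B b) /\ v (q (1 : R)) = \sum_(b <- s) c b *: b.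
  have [s [c [sB vE]]] := Bspan (v (q (1 : R))).
  (* A basis vector may be listed several times; its coefficients add up. *)
  exists (undup s), (fun b => c b *+ count_mem b s).
  split; [exact: undup_uniq|split=> [b|]].
    by rewrite mem_undup; apply: sB.
  rewrite vE -big_undup_iterop_count; apply: eq_bigr => b _.
  by rewrite -[iterop _ _ _ _]/(c b *: b *+ count_mem b s) scalerMnl.
have [n Hn] : eventually (fun n =>
    forall b, b \in s -> exists r, w b = r *: gamma n).
  by apply: eventually_all => b _; apply: (bass_span bass).
have /choice[d dE] : forall b, exists r, b \in s -> w b = r *: gamma n.
  move=> b; have [bs|_] := boolP (b \in s); last by exists 0.
  by have [r ->] := Hn n (leqnn n) b bs; exists r.
have g0 : gamma 0 = (\sum_(b <- s) c b * d b) *: gamma n.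
  have -> : gamma 0 = u (q (1 : R)) by rewrite uE /= /regular_map scale1r.
  rewrite uvw vE linear_sum scaler_suml big_seq [RHS]big_seq.
  by apply: eq_bigr => b bs; rewrite linearZ /= (dE b bs) scalerA.
have /bass_eq0[m n_m /eqP] : (\sum_(b <- s) c b * d b - seg 0 n) *: gamma n = 0.
  by rewrite scalerBl -g0 -(bass_seg bass) // subrr.
rewrite mulrBl subr_eq0 => /eqP; rewrite -(big_cat_nat (leq0n n) n_m) /= => m0.
exists m => k m_k r rk.
have qr0 : q r = 0.
  apply/q0; rewrite /= /regular_map (bass_seg bass (leq0n k)) scalerA rk.
  exact: scale0r.
have rc0 b : b \in s -> r * c b = 0.
  apply: (Bfree s (fun b => r * c b)) => //.
  rewrite -(eq_bigr _ (fun b _ => scalerA r (c b) b)) -scaler_sumr -vE.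
  by rewrite -!linearZ /= [_ *: _]mulr1 qr0 linear0.
rewrite -m0 mulrA mulr_sumr big_seq big1 ?mul0r // => b bs.
by rewrite mulrA rc0 ?mul0r.
Qed.

End Theory.
End BassModule.

(** * The chain condition and idempotents *)

Section DCC.
Variable R : pzRingType.

(** Each product contains the factor [a 0], so that chains which start from a
prescribed principal right ideal are covered. *)
Definition principal_dcc : Prop := forall a : nat -> R,
  exists m c, \prod_(0 <= k < m.+1) a k = \prod_(0 <= k < m.+2) a k * c.

Lemma finitely_projective_dcc : self_left_FP_injective R ->
  (forall M : lmodType R, flat M -> finitely_projective M) -> principal_dcc.
Proof.
move=> injR fpR a; have [G [gamma [lev bass]]] := bass_exists a.
have [m Hm] := bass_annihilator bass (fpR _ (bass_flat bass)).
exists m; apply: (FP_injective_divides injR) => r r0.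
by rewrite big_nat_recr // mulrA (Hm m.+2) ?mul0r // ltnW.
Qed.

(** The chain condition turned into a minimality principle for aR, by dependent
choice.  Without it one could keep multiplying by elements b that preserve [Q]
and strictly shrink the right ideal. *)
Lemma dcc_minimal (Q : R -> Prop) (a0 : R) : principal_dcc -> Q a0 ->
  exists a, [/\ Q a, exists t, a = a0 * t &
    forall b, Q (a * b) -> exists c, a = a * b * c].
Proof.
move=> dccR Qa0; apply: contrapT => none.
have next a : exists b, (Q a /\ exists t, a = a0 * t) ->
    Q (a * b) /\ ~ exists c, a = a * b * c.
  have [[Qa at0]|] := pselect (Q a /\ exists t, a = a0 * t); last by exists 0.
  apply: contrapT => nb; apply: none; exists a; split=> // b Qab.
  by apply: contrapT => nc; apply: nb; exists b.
have [g gP] := choice next.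
pose A n := iter n (fun a => a * g a) a0.
have AP n : Q (A n) /\ exists t, A n = a0 * t.
  elim: n => [|n IH]; first by split=> //; exists 1; rewrite mulr1.
  have [Qn _] := gP _ IH; split=> //.
  by have [_ [t At]] := IH; exists (t * g (A n)); rewrite mulrA -At.
pose s n := if n is n'.+1 then g (A n') else a0.
have prodA n : \prod_(0 <= k < n.+1) s k = A n.
  by elim: n => [|n IH]; rewrite ?big_nat1 // big_nat_recr //= IH.
have [m [c]] := dccR s; rewrite !prodA => Am.
by have [_] := gP _ (AP m); apply; exists c.
Qed.

End DCC.

Section Idempotents.
Variable R : pzRingType.

Definition nilpotent (x : R) : Prop := exists k, x ^+ k = 0.

(** For f = bu, e = 1 - (1 - f ^ k) ^ k is a polynomial in f divisible by f ^
k, while 1 - e is divisible by (1 - f) ^ k; as f (1 - f) is nilpotent, e (1 -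
e) = 0 for large k.  The hypothesis b f = b passes on to b e = b. *)
Lemma lift_idempotent (b u : R) : b * (b * u) = b ->
  nilpotent (b * u * (1 - b * u)) ->
  exists t, [/\ b * t * (b * t) = b * t & b * (b * t) = b].
Proof.
set f := b * u => bf [k0 nk0].
(* A positive exponent makes e a right multiple of f, hence of b. *)
pose k := k0.+1; have nk : (f * (1 - f)) ^+ k = 0 by rewrite exprS nk0 mulr0.
have cf : GRing.comm f (1 - f) by apply: commrB; [exact: commr1|].
pose y := f ^+ k; pose S := \sum_(i < k) (1 - y) ^+ i.
pose H := \sum_(i < k) f ^+ i.
pose e := y * S.
have e1 : 1 - e = (1 - y) ^+ k.
  have := subrX1 (1 - y) k; rewrite -/S => /(canRL (subrK _)) ->.
  by rewrite addrAC subrr add0r mulNr addrC.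
have yH : 1 - y = (1 - f) * H.
  by rewrite -opprB subrX1 -mulNr opprB.
have e1' : 1 - e = (1 - f) ^+ k * H ^+ k.
  rewrite e1 yH exprMn_comm //; apply: commr_sum => i _; apply: commrX.
  exact/commr_sym.
have ce : y * S = S * y.
  apply: commr_sum => i _; apply: commrX; apply: commrB; [exact: commr1|by []].
have ee : e * e = e.
  apply/eqP; rewrite eq_sym -subr_eq0 -[X in X - _]mulr1 -mulrBr e1'.
  by rewrite /e ce -mulrA (mulrA y) -exprMn_comm // nk mul0r mulr0.
have be : b * e = b.
  apply/eqP; rewrite eq_sym -subr_eq0 -[X in X - _]mulr1 -mulrBr e1'.
  by rewrite exprS !mulrA mulrBr mulr1 bf subrr !mul0r.
exists (u * (f ^+ k0 * S)).
have -> : b * (u * (f ^+ k0 * S)) = e by rewrite /e /y exprS -/f !mulrA.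
by [].
Qed.

Hypothesis dccR : principal_dcc R.

(** Take bR minimal among the right ideals generated by a non-nilpotent
multiple of k.  As b b is not nilpotent, b = b b u for some u, and f = bu
satisfies b f = b.  An element n of bR with b n = 0 is nilpotent: otherwise b
would be in nR, so b b = 0.  This applies to n = f (1 - f). *)
Lemma nonnilpotent_idempotent (k : R) : ~ nilpotent k ->
  exists t, k * t * (k * t) = k * t /\ k * t <> 0.
Proof.
move=> nk.
have [b [nb [t0 bE] bmin]] := dcc_minimal (Q := fun x => ~ nilpotent x) dccR nk.
have bneq0 : b <> 0 by move=> b0; apply: nb; exists 1%N; rewrite b0.
have nbb : ~ nilpotent (b * b).
  by move=> [m bm]; apply: nb; exists (2 * m)%N; rewrite exprM expr2.
have [u bu] := bmin b nbb.
have bf : b * (b * u) = b by rewrite mulrA -bu.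
have [|t [ee be]] := lift_idempotent bf.
  apply: contrapT => nn.
  have bn : b * (b * u * (1 - b * u)) = 0.
    by rewrite mulrA bf mulrBr mulr1 bf subrr.
  rewrite -mulrA in nn; have [v bv] := bmin _ nn.
  apply: bneq0; rewrite -bf mulrA.
  have -> : b * b = b * (b * u * (1 - b * u)) * v by rewrite {2}bv !mulrA.
  by rewrite bn !mul0r.
exists (t0 * t); have -> : k * (t0 * t) = b * t by rewrite bE mulrA.
split=> // e0.
by apply: bneq0; rewrite -be e0 mulr0.
Qed.

(** Choose aR minimal with aX <> 0, then bR minimal with abX <> 0; b can be
replaced by a b1 with a b1 = a.  As in [nonnilpotent_idempotent], b1 yields an
idempotent e of b1 R, with a e = a: a nonnilpotent f (1 - f) would give a
nonzero idempotent g of b1 R with b1 g = 0, and (1 - g) b1 would contradict the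
minimality of b1.  Take y = e z with a z <> 0.  If r y is in IX then y is a sum
of terms c w with r e c in I; for one of them a e c w <> 0, so by minimality e
is in ecR and r e is in I. *)
Lemma idempotent_element (X : lmodType R) (x : X) :
  ideal_transfer X -> x != 0 ->
  exists (e : R) (y : X), [/\ e * e = e, e *: y = y, y != 0 &
    forall I r, right_ideal I -> ideal_span I (r *: y) -> I (r * e)].
Proof.
move=> trX x0.
pose Q (a : R) := exists z : X, a *: z != 0.
have Q1 : Q 1 by exists x; rewrite scale1r.
have [a [Qa _ amin]] := dcc_minimal dccR Q1.
have Qa1 : Q (a * 1) by rewrite mulr1.
have [b [Qb _ bmin]] := dcc_minimal (Q := fun b => Q (a * b)) dccR Qa1.
have [s abs] := amin b Qb.
pose b1 := b * s; have ab1 : a * b1 = a by rewrite mulrA -abs.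
have b1min c : Q (a * (b1 * c)) -> exists d, b1 = b1 * c * d.
  move=> Qc; have [|d bd] := bmin (s * c); first by rewrite (mulrA b).
  by exists (d * s); rewrite {1}/b1 {1}bd !mulrA.
have [|u bu] := b1min b1; first by rewrite mulrA !ab1.
have bf : b1 * (b1 * u) = b1 by rewrite mulrA -bu.
have [|t [ee be]] := lift_idempotent bf.
  apply: contrapT => /nonnilpotent_idempotent[t].
  set g := _ * t => -[gg]; apply.
  have bg : b1 * g = 0.
    by rewrite /g mulrA (mulrA b1 (b1 * u)) bf mulrBr mulr1 bf subrr mul0r.
  have gE : g = b1 * (u * (1 - b1 * u) * t) by rewrite /g !mulrA.
  clearbody g.
  have ag : a * g = 0 by rewrite -ab1 -mulrA bg mulr0.
  have gbE : b1 * (1 - u * (1 - b1 * u) * t * b1) = (1 - g) * b1.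
    by rewrite mulrBr mulrBl mulr1 mul1r gE !mulrA.
  have [|d bd] := b1min (1 - u * (1 - b1 * u) * t * b1).
    by rewrite gbE mulrA mulrBr ag subr0 mulr1 ab1.
  have gb : g * b1 = 0 by rewrite bd gbE !mulrA mulrBr mulr1 gg subrr !mul0r.
  by rewrite -gg {2}gE mulrA gb mul0r.
have {Qa} [z az] := Qa.
pose e := b1 * t; rewrite -/e in ee be.
have ae : a * e = a by rewrite -ab1 -mulrA be.
exists e, (e *: z); split=> //.
- by rewrite scalerA ee.
- by apply: contraNneq az => ez; rewrite -ae -scalerA ez scaler0.
move=> I r rI; rewrite -[e in r *: (e *: z)]ee -scalerA scalerA.
move=> /(trX _ _ _ rI)[w [wI yE]].
have [p pw ap] : exists2 p, p \in w & a *: (e *: (p.1 *: p.2)) != 0.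
  apply: contrapT => np; move/negP: az; apply; apply/eqP.
  rewrite -ae -ee mulrA -(scalerA (a * e)) -(scalerA a) yE !scaler_sumr.
  rewrite big_seq big1 // => p pw.
  by apply: contrapT => /eqP ap; apply: np; exists p.
have [|d ed] := b1min (t * p.1).
  by exists p.2; rewrite (mulrA b1) -/e mulrA -(scalerA (a * e)) -(scalerA a).
have -> : r * e = r * e * p.1 * (d * t).
  by rewrite {1}/e {1}ed /e !mulrA.
by apply: (right_idealM rI); apply: wI.
Qed.

End Idempotents.

(** * Exhausting a flat module by cyclic projectives *)

Section Exhaustion.
Variables (R : pzRingType) (M : lmodType R).

(** Indexing the free module by all pairs, rather than by [C], keeps its type
independent of the family. *)
Definition family_map (C : set (M * R)) :
    {linear freeMod R (M * R)%type -> M} :=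
  free_lift (fun p => if `[< C p >] then p.1 else 0).

(** The pairs are (y, e) with y = e y.  The case I = 0 of the second condition
says that the sum of the modules Ry is direct with Ry isomorphic to Re; the
general case says that the intersection of the sum with IM is I times the sum.
*)
Definition pure_family (C : set (M * R)) : Prop :=
  (forall p, C p -> p.2 *: p.1 = p.1) /\
  forall I x, right_ideal I -> ideal_span I (family_map C x) ->
    forall p, C p -> I (coeff x p * p.2).

Lemma family_map_delta (C : set (M * R)) p :
  C p -> family_map C (delta R p) = p.1.
Proof. by move=> Cp; rewrite /= free_lift_delta asboolT. Qed.

Lemma chain_member (F : set (set (M * R))) (p0 : M * R) (s : seq (M * R)) :
  total_on F subset -> (\bigcup_(D in F) D)%classic p0 ->
  exists D, [/\ F D, D p0 &
    forall p, p \in s -> (\bigcup_(D in F) D)%classic p -> D p].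
Proof.
move=> totF [D0 FD0 D0p0]; elim: s => [|p s [D [FD Dp0 Ds]]].
  by exists D0; split.
have [[E FE Ep]|np] := pselect ((\bigcup_(D in F) D)%classic p); last first.
  by exists D; split=> // r; rewrite inE => /orP[/eqP -> /np|/Ds].
have [DE|ED] := totF D E FD FE.
  exists E; split=> // [|r]; first exact: DE.
  by rewrite inE => /orP[/eqP -> //|/Ds rD /rD /DE].
exists D; split=> // r.
by rewrite inE => /orP[/eqP -> _|/Ds //]; apply: ED.
Qed.

(** The condition defining a pure family involves finitely many members at a
time, so it is preserved by unions of chains. *)
Lemma maximal_pure_family : exists C, pure_family C /\
  forall D, (C `<` D)%classic -> ~ pure_family D.
Proof.
apply: Zorn_bigcup => F FP totF; split=> [p [D FD Dp]|I x rI xI p Cp].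
  exact: (FP D FD).1.
have [D [FD Dp Ds]] := chain_member (supp x) totF Cp.
apply: (FP D FD).2 Dp => //; move: xI; congr (ideal_span _ _).
rewrite /= /free_lift big_seq [RHS]big_seq; apply: eq_bigr => r /Ds rD.
congr (_ *: _); have [Dr|nDr] := pselect (D r).
  by rewrite !asboolT //; exists D.
by rewrite !asboolF // => /rD.
Qed.

Section Adjoin.
Variables (C : set (M * R)) (pureC : pure_family C).
Variables (X : lmodType R) (q : {linear M -> X}) (q_surj : surj q).
Hypothesis q0 : forall y, q y = 0 <-> exists x, family_map C x = y.

(** Suppose r y = z + s with z in IM and s in the span of the family.  Then s
is in JM for J = rR + I, so by purity its coefficients, multiplied by the
idempotents, have the form r c_p + i_p with i_p in I.  Subtracting from y the
combination of the family with coefficients c_p gives an element congruent to y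
which r multiplies into IM. *)
Lemma quotient_ideal_transfer : ideal_transfer M -> ideal_transfer X.
Proof.
move=> trM I r v rI; have [y <-] := q_surj v => -[s [sI ry]].
have [t tK] := choice q_surj.
pose z := \sum_(p <- s) p.1 *: t p.2.
have zI : ideal_span I z.
  rewrite /z big_seq; apply: big_ind; [exact: ideal_span0|exact: ideal_spanD|].
  by move=> p /sI; apply: ideal_spanZ.
have [f fE] : exists f, family_map C f = r *: y - z.
  apply/q0; rewrite linearB linearZ /= ry /z linear_sum; apply/eqP.
  by rewrite subr_eq0; apply/eqP/eq_bigr => p _; rewrite linearZ /= tK.
pose J (b : R) := exists c, I (b - r * c).
have rJ : right_ideal J.
  have [I0 ID] := rI; split=> [|a b b' [c bc] [c' bc']].
    by exists 0; rewrite mulr0 subr0.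
  exists (c * (a : R) + c').
  change (I ((b : R) * (a : R) + (b' : R) - r * (c * (a : R) + c'))).
  rewrite mulrDr opprD addrACA mulrA -mulrBl.
  exact: (ID a _ _ bc bc').
have IJ b : I b -> J b by exists 0; rewrite mulr0 subr0.
have Jr : J r by exists 1; rewrite mulr1 subrr; case: rI.
have fJ : ideal_span J (family_map C f).
  rewrite fE; apply: ideal_spanB => //; first exact: ideal_spanZ.
  by have [w [wI ->]] := zI; exists w; split=> // p /wI /IJ.
have /choice[c cP] : forall p, exists c, C p -> I (coeff f p * p.2 - r * c).
  move=> p; have [Cp|] := pselect (C p); last by exists 0.
  by have [c Ic] := pureC.2 _ _ rJ fJ p Cp; exists c.
pose g := \sum_(p <- supp f) c p *: delta R p.
have ->: q y = q (y - family_map C g).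
  by rewrite linearB [X in _ - X](_ : _ = 0) ?subr0 //; apply/q0; exists g.
suff /(trM _ _ _ rI)[w [wI ->]] : ideal_span I (r *: (y - family_map C g)).
  exists [seq (p.1, q p.2) | p <- w].
  split=> [_ /mapP[p pw ->]|]; first exact: wI.
  by rewrite big_map linear_sum; apply: eq_bigr => p _; rewrite linearZ.
have -> : r *: (y - family_map C g) =
    z + (family_map C f - r *: family_map C g).
  by rewrite fE scalerBr addrA [z + _]addrC subrK.
apply: ideal_spanD zI _.
rewrite /g linear_sum scaler_sumr {1}[f]free_sum linear_sum -sumrB.
apply: ideal_span_sum => p; rewrite !linearZ /= !scalerN free_lift_delta.
have [Cp|nCp] := pselect (C p); last first.
  by rewrite asboolF // !scaler0 subrr; apply: ideal_span0.
rewrite asboolT // -{1}(pureC.1 p Cp) !scalerA -scalerBl.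
by apply/ideal_spanZ/cP.
Qed.

(** A relation modulo IM in the enlarged family reduces, modulo the span of
[C], to one on the new generator alone.  So the new coefficient times e is in
I, the corresponding term is in IM, and the relation becomes one in [C]. *)
Lemma pure_family_adjoin (e : R) (y : M) : e *: y = y -> q y != 0 ->
  (forall I r, right_ideal I -> ideal_span I (r *: q y) -> I (r * e)) ->
  (C `<` C `|` [set (y, e)])%classic /\
    pure_family (C `|` [set (y, e)])%classic.
Proof.
move=> ey qy0 ePure.
have nC : ~ C (y, e).
  move=> Cye; move/eqP: qy0; apply; apply/q0; exists (delta R (y, e)).
  exact: family_map_delta.
split.
  split=> [p Cp|sub]; first by left.
  by apply/nC/sub; right.
split=> [p [/pureC.1 //|-> //]|I x rI].
have -> : family_map (C `|` [set (y, e)])%classic x =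
    family_map C x + coeff x (y, e) *: y.
  pose psi p : M := if p == (y, e) then y else 0.
  have -> : coeff x (y, e) *: y = free_lift psi x.
    rewrite (@free_liftE _ _ _ psi x (undup ((y, e) :: supp x))) ?undup_uniq //.
      rewrite (bigD1_seq (y, e)) ?undup_uniq ?mem_undup ?mem_head //= /psi eqxx.
      by rewrite big1 ?addr0 // => p /negPf ->; rewrite scaler0.
    by move=> p /mem_supp ps; rewrite mem_undup inE ps orbT.
  rewrite /family_map /= /free_lift -big_split; apply: eq_bigr => p _ /=.
  rewrite -scalerDr /psi; congr (_ *: _); case: eqP => [->|pn].
    by rewrite asboolT ?asboolF ?add0r //; right.
  rewrite addr0; have [Cp|nCp] := pselect (C p).
    by rewrite !asboolT //; left.
  by rewrite !asboolF // => -[].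
move=> xI.
have Ie : I (coeff x (y, e) * e).
  apply: ePure => //.
  have -> : coeff x (y, e) *: q y = q (family_map C x + coeff x (y, e) *: y).
    have qx : q (family_map C x) = 0 by apply/q0; exists x.
    by rewrite linearD qx add0r linearZ.
  have [w [wI ->]] := xI.
  exists [seq (p.1, q p.2) | p <- w].
  split=> [_ /mapP[p pw ->]|]; first exact: wI.
  by rewrite big_map linear_sum; apply: eq_bigr => p _; rewrite linearZ.
move=> p [Cp|-> //]; apply: (pureC.2 I x rI _ p Cp).
have -> : family_map C x =
    (family_map C x + coeff x (y, e) *: y) - (coeff x (y, e) * e) *: y.
  by rewrite -scalerA ey addrK.
by apply: ideal_spanB => //; apply: ideal_spanZ.
Qed.

End Adjoin.

Lemma maximal_pure_family_spans (C : set (M * R)) :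
  principal_dcc R -> ideal_transfer M -> pure_family C ->
  (forall D, (C `<` D)%classic -> ~ pure_family D) -> surj (family_map C).
Proof.
move=> dccR trM pureC maxC m; apply: contrapT => nm.
have subS : submodule (fun y => exists x, family_map C x = y).
  split=> [|a _ _ [x <-] [x' <-]]; first by exists 0; rewrite linear0.
  by exists (a *: x + x'); rewrite linearP.
have [X [q [q_surj q0]]] := quotient_exists subS.
have qm0 : q m != 0 by apply/eqP => /q0.
have trX := quotient_ideal_transfer pureC q_surj q0 trM.
have [e [v [ee ev v0 ePure]]] := idempotent_element dccR trX qm0.
have [y qy] := q_surj v.
have qey : q (e *: y) = v by rewrite linearZ /= qy.
have [|||CD pureD] := @pure_family_adjoin C pureC X q q0 e (e *: y).
- by rewrite scalerA ee.
- by rewrite qey.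
- by rewrite qey.
exact: maxC CD pureD.
Qed.

(** The member (y, e) is sent to e n, for a preimage n of f(y); the condition
of purity for the zero ideal says that this is well defined. *)
Lemma pure_family_projective (C : set (M * R)) :
  pure_family C -> surj (family_map C) -> projective M.
Proof.
move=> [Ce Cpure] C_surj A N g f g_surj.
have [n nE] := choice (fun p : M * R => g_surj (f p.1)).
pose k : {linear freeMod R (M * R)%type -> A} :=
  free_lift (fun p => if `[< C p >] then p.2 *: n p else 0).
have k0 x : family_map C x = 0 -> k x = 0.
  move=> x0; rewrite /k /= /free_lift big1 // => p _.
  have [Cp|nCp] := pselect (C p); last by rewrite asboolF // scaler0.
  rewrite asboolT // scalerA.
  rewrite (Cpure (fun r => r = 0)) ?scale0r //.
    by split=> // a _ _ -> ->; rewrite scaler0 addr0.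
  by rewrite x0; apply: ideal_span0.
have [h hE] := linear_factor C_surj k0; exists h => m.
have [x <-] := C_surj m; rewrite hE.
apply: (free_linear_ext (h := g \o k) (k := f \o family_map C)) x => p.
rewrite /= !free_lift_delta; case: asboolP => [Cp|_]; last by rewrite !linear0.
by rewrite linearZ /= nE -linearZ /= Ce.
Qed.

End Exhaustion.

Lemma dcc_left_perfect (R : pzRingType) : principal_dcc R -> left_perfect R.
Proof.
move=> dccR M flatM; have [C [pureC maxC]] := maximal_pure_family M.
apply: (pure_family_projective pureC); apply: maximal_pure_family_spans => //.
exact: flat_ideal_transfer.
Qed.

Lemma projective_finitely_projective (R : pzRingType) (M : lmodType R) :
  projective M -> finitely_projective M.
Proof.
move=> projM N u _; pose p : {linear freeMod R M -> M} := free_lift id.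
have p_surj : surj p.
  by move=> m; exists (delta R m); rewrite /= free_lift_delta.
have [h hE] := projM _ _ p (idfun : {linear M -> M}) p_surj.
exists (freeMod R M : lmodType R), (h \o u), p.
split; first exact: freeMod_free.
by move=> x; rewrite /= hE.
Qed.

Theorem proposition3p3 (R : pzRingType) :
  self_left_FP_injective R ->
  ((forall M : lmodType R, flat M -> finitely_projective M) <-> left_perfect R).
Proof.
move=> injR; split=> [fpR|perfR M flatM].
  exact/dcc_left_perfect/finitely_projective_dcc.
exact/projective_finitely_projective/perfR.
Qed.
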